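(* Let $m=2$. All the $\mathrm{Vect}(M)$-modules $\mathcal{D}^1_{\underline\lambda;1+|\underline\lambda|}$ (i.e. of shift $\delta=1$), $\underline\lambda=(\lambda_1,\lambda_2)\in\mathbb{R}^2$, are isomorphic to each other, with one exception, the module $\mathcal{D}^1_{\underline 0;1}$: for all $\underline\lambda,\underline\rho\in\mathbb{R}^2\setminus\{\underline 0\}$ one has $\mathcal{D}^1_{\underline\lambda;1+|\underline\lambda|}\simeq\mathcal{D}^1_{\underline\rho;1+|\underline\rho|}$, and $\mathcal{D}^1_{\underline\lambda;1+|\underline\lambda|}\not\simeq\mathcal{D}^1_{\underline 0;1}$ for $\underline\lambda\ne\underline 0$.
   Context: $M$ is $\mathbb{R}$ or $S^1$. For $\lambda\in\mathbb{R}$, $\mathcal{F}_\lambda$ is the space of smooth $\lambda$-densities $a\,(dx)^\lambda$ on $M$, with the $\mathrm{Vect}(M)$-action $L_X^\lambda(a\,(dx)^\lambda)=(Xa'+\lambda X'a)(dx)^\lambda$ for $X=X(x)\partial_x$. For $\underline\lambda=(\lambda_1,\lambda_2)$, $|\underline\lambda|=\lambda_1+\lambda_2$. $\mathcal{D}^k_{\underline\lambda;\mu}$ is the space of bidifferential operators of order $\le k$, $A=\sum_{i_1+i_2\le k}a_{i_1,i_2}\,\partial_{i_1,i_2}:\mathcal{F}_{\lambda_1}\otimes\mathcal{F}_{\lambda_2}\to\mathcal{F}_\mu$, with $a_{i_1,i_2}$ smooth functions and $\partial_{i_1,i_2}(\varphi_1,\varphi_2)=\varphi_1^{(i_1)}\varphi_2^{(i_2)}$;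 it is a $\mathrm{Vect}(M)$-module via $L_X^{\underline\lambda;\mu}(A)=L_X^\mu\circ A-A(L_X^{\lambda_1}(-),-)-A(-,L_X^{\lambda_2}(-))$. Isomorphism means isomorphism of $\mathrm{Vect}(M)$-modules. *)

(* Defs.v *)
From HB Require Import structures.
From mathcomp Require Import all_boot all_order all_algebra.
From mathcomp Require Import all_classical all_reals all_analysis.
From mathcomp Require Import ring.
Set Implicit Arguments.
Unset Strict Implicit.
Unset Printing Implicit Defensive.
Import Order.TTheory GRing.Theory Num.Theory.
Import numFieldNormedType.Exports.
Local Open Scope classical_set_scope.
Local Open Scope ring_scope.

Inductive manifold1 := RealLine | Circle.

Definition smooth (R : realType) (f : R -> R) :=
  forall (n : nat) (x : R), derivable (derive1n n f) x 1.

(* The circle is R / 2 pi Z: its smooth functions are the smooth functions of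
   the angular coordinate x that are 2 pi-periodic. *)
Definition smooth_on (R : realType) (M : manifold1) (f : R -> R) : Prop :=
  smooth f /\ (if M is Circle then periodic f (pi *+ 2) else True).

Section SmoothFunctions.
Variable R : realType.
Implicit Types f g : R -> R.

Inductive smooth_gen : (R -> R) -> Prop :=
| gen_smooth f : smooth f -> smooth_gen f
| gen_add f g : smooth_gen f -> smooth_gen g -> smooth_gen (f + g)
| gen_mul f g : smooth_gen f -> smooth_gen g -> smooth_gen (f * g).

Lemma smooth_derivable f x : smooth f -> derivable f x 1.
Proof. by move=> sf; exact: (sf 0%N). Qed.

Lemma smooth_derive1 f : smooth f -> smooth (derive1 f).
Proof. by move=> sf n x; have := sf n.+1 x; rewrite derive1Sn. Qed.

Lemma derive1D_fun f g : (forall x, derivable f x 1) ->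
  (forall x, derivable g x 1) -> derive1 (f + g) = (derive1 f) + (derive1 g).
Proof.
by move=> df dg; apply/funext => x; rewrite derive1E deriveD // -!derive1E.
Qed.

Lemma derive1M_fun f g : (forall x, derivable f x 1) ->
  (forall x, derivable g x 1) -> derive1 (f * g) = (derive1 f) * g + f * (derive1 g).
Proof.
move=> df dg; apply/funext => x; rewrite derive1E deriveM // -!derive1E.
by rewrite /GRing.add /= /GRing.mul /= addrC; congr (_ + _); rewrite mulrC.
Qed.

Lemma smooth_genP f : smooth_gen f ->
  (forall x, derivable f x 1) /\ smooth_gen (derive1 f).
Proof.
elim=> {f} [f sf|f g gf [df gdf] gg [dg gdg]|f g gf [df gdf] gg [dg gdg]].
- by split=> [x|]; [exact: smooth_derivable|exact/gen_smooth/smooth_derive1].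
- by split=> [x|]; [exact: derivableD|rewrite derive1D_fun//; exact: gen_add].
- split=> [x|]; first exact: derivableM.
  by rewrite derive1M_fun//; apply: gen_add; exact: gen_mul.
Qed.

Lemma smooth_gen_smooth f : smooth_gen f -> smooth f.
Proof.
move=> gf n; elim: n f gf => [|n IHn] f /smooth_genP[df gdf] x //.
by rewrite derive1Sn; exact: IHn.
Qed.

Lemma smoothD f g : smooth f -> smooth g -> smooth (f + g).
Proof. by move=> ? ?; apply/smooth_gen_smooth/gen_add; exact: gen_smooth. Qed.

Lemma smoothM f g : smooth f -> smooth g -> smooth (f * g).
Proof. by move=> ? ?; apply/smooth_gen_smooth/gen_mul; exact: gen_smooth. Qed.

Lemma derive1_cst_fun (c : R) : derive1 (cst c : R -> R) = cst 0.
Proof. by apply/funext => x; rewrite derive1_cst. Qed.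

Lemma smooth_cst (c : R) : smooth (cst c).
Proof.
move=> n; elim: n c => [|n IHn] c x; first exact: (derivable_cst (c : R^o)).
by rewrite derive1Sn derive1_cst_fun; exact: IHn.
Qed.

Lemma periodic_derive1 f T : periodic f T -> periodic (derive1 f) T.
Proof.
move=> pf u; rewrite /derive1 pf.
suff -> : (fun h => h^-1 *: (f (h + (u + T)) - f u)) =
          (fun h => h^-1 *: (f (h + u) - f u)) by [].
by apply/funext => h; rewrite addrA pf.
Qed.

Variable M : manifold1.

Lemma smooth_onD f g : smooth_on M f -> smooth_on M g -> smooth_on M (f + g).
Proof.
move=> [sf pf] [sg pg]; split; first exact: smoothD.
by case: M pf pg => // pf pg u; rewrite /GRing.add /= pf pg.
Qed.

Lemma smooth_onM f g : smooth_on M f -> smooth_on M g -> smooth_on M (f * g).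
Proof.
move=> [sf pf] [sg pg]; split; first exact: smoothM.
by case: M pf pg => // pf pg u; rewrite /GRing.mul /= pf pg.
Qed.

Lemma smooth_on_cst (c : R) : smooth_on M (cst c).
Proof. by split; [exact: smooth_cst|case: M]. Qed.

Lemma smooth_on_derive1 f : smooth_on M f -> smooth_on M (derive1 f).
Proof.
move=> [sf pf]; split; first exact: smooth_derive1.
by case: M pf => // pf; exact: periodic_derive1.
Qed.

Definition smooth_on_pred : {pred R -> R} := fun f => `[< smooth_on M f >].

Record smoothfun := SmoothFun {
  smoothfun_val :> R -> R;
  smoothfunP : smoothfun_val \in smooth_on_pred }.

HB.instance Definition _ := [isSub of smoothfun for smoothfun_val].
HB.instance Definition _ := [Choice of smoothfun by <:].

Lemma scale_cstE (c : R) f : c *: f = cst c * f.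
Proof. by apply/funext. Qed.

Lemma smooth_on_subring : subring_closed smooth_on_pred.
Proof.
split=> [|f g /asboolP sf /asboolP sg|f g /asboolP sf /asboolP sg];
  apply/asboolP; first exact: smooth_on_cst.
- apply: smooth_onD => //; have -> : - g = cst (-1) * g.
    by apply/funext => x; rewrite /GRing.mul /= mulN1r.
  by apply: smooth_onM => //; exact: smooth_on_cst.
- exact: smooth_onM.
Qed.

Lemma smooth_on_submod : subsemimod_closed smooth_on_pred.
Proof.
split; first split=> [|f g /asboolP sf /asboolP sg].
- by apply/asboolP; exact: smooth_on_cst.
- by apply/asboolP; exact: smooth_onD.
move=> c f /asboolP sf; apply/asboolP; rewrite scale_cstE.
by apply: smooth_onM => //; exact: smooth_on_cst.
Qed.

HB.instance Definition _ :=
  GRing.SubChoice_isSubComPzRing.Build _ _ smoothfun smooth_on_subring.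
HB.instance Definition _ :=
  GRing.SubZmodule_isSubLmodule.Build _ _ _ smoothfun smooth_on_submod.
End SmoothFunctions.

Section VectorFields.
Variables (R : realType) (M : manifold1).
Local Notation C := (smoothfun R M).
Implicit Types (f g X Y : C) (c : R).

Lemma derive_subproof f : derive1 f \in smooth_on_pred M.
Proof. by apply/asboolP/smooth_on_derive1/asboolP/smoothfunP. Qed.

Definition deriv f : C := SmoothFun (derive_subproof f).

(* The vector field X(x) d/dx is represented by its coefficient function X. *)
Definition Vect : lmodType R := C.

Definition vect_bracket (X Y : C) : C := X * deriv Y - Y * deriv X.

Lemma smoothfun_derivable f x : derivable f x 1.
Proof. by apply: smooth_derivable; have /asboolP[] := smoothfunP f. Qed.

Lemma derivD f g : deriv (f + g) = deriv f + deriv g.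
Proof.
by apply/val_inj; rewrite /= derive1D_fun//; exact: smoothfun_derivable.
Qed.

Lemma derivM f g : deriv (f * g) = deriv f * g + f * deriv g.
Proof.
by apply/val_inj; rewrite /= derive1M_fun//; exact: smoothfun_derivable.
Qed.

Lemma cst_subproof c : cst c \in smooth_on_pred M.
Proof. exact/asboolP/smooth_on_cst. Qed.

Definition constf c : C := SmoothFun (cst_subproof c).

Lemma scale_constf c f : c *: f = constf c * f.
Proof. exact/val_inj. Qed.

Lemma deriv_constf c : deriv (constf c) = 0.
Proof. by apply/val_inj => /=; rewrite derive1_cst_fun. Qed.

Lemma derivZ c f : deriv (c *: f) = c *: deriv f.
Proof. by rewrite !scale_constf derivM deriv_constf mul0r add0r. Qed.

Lemma derivN f : deriv (- f) = - deriv f.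
Proof. by rewrite -scaleN1r derivZ scaleN1r. Qed.

Lemma deriv_is_linear : linear deriv.
Proof. by move=> c f g; rewrite derivD derivZ. Qed.

HB.instance Definition _ := GRing.isLinear.Build R C C *:%R deriv deriv_is_linear.

Record vect_module := VectModule {
  vm_sort :> lmodType R;
  vm_act : Vect -> vm_sort -> vm_sort;
  vm_act_linearl : forall v, linear (vm_act^~ v);
  vm_act_linearr : forall X, linear (vm_act X);
  vm_act_bracket : forall X Y v,
    vm_act (vect_bracket X Y) v =
      vm_act X (vm_act Y v) - vm_act Y (vm_act X v) }.

Definition vect_isomorphic (V W : vect_module) : Prop :=
  exists T : {linear V -> W},
    bijective T /\ forall X v, T (vm_act X v) = vm_act X (T v).

(* The density a (dx)^lambda is represented by its coefficient function a. *)
Definition dens_act (lambda : R) (X f : C) : C :=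
  X * deriv f + lambda *: (deriv X * f).

Lemma dens_act_linearl lambda f : linear ((dens_act lambda)^~ f).
Proof.
move=> c X Y; rewrite /dens_act derivD derivZ !scale_constf; ring.
Qed.

Lemma dens_act_linearr lambda X : linear (dens_act lambda X).
Proof.
move=> c f g; rewrite /dens_act derivD derivZ !scale_constf; ring.
Qed.

Lemma dens_act_bracket lambda X Y f :
  dens_act lambda (vect_bracket X Y) f =
    dens_act lambda X (dens_act lambda Y f) -
    dens_act lambda Y (dens_act lambda X f).
Proof.
rewrite /dens_act /vect_bracket !scale_constf.
rewrite !(derivD, derivN, derivM, deriv_constf); ring.
Qed.

Definition density (lambda : R) : vect_module :=
  VectModule (dens_act_linearl lambda) (dens_act_linearr lambda)
             (dens_act_bracket lambda).
End VectorFields.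

Section BidifferentialOperators.
Variables (R : realType) (M : manifold1).
Local Notation C := (smoothfun R M).
Local Notation D := (@deriv R M).
Implicit Types (f g X Y : C) (c : R).

(* Maps on the tensor product of two spaces of densities are encoded as curried
   functions; bilinearity follows from the formula below. *)
Definition is_bidiff (k : nat) (A : C -> C -> C) : Prop :=
  exists a : nat -> nat -> C, forall f g,
    A f g = \sum_(i < k.+1) \sum_(j < k.+1 | (i + j <= k)%N)
              a i j * (iter i D f * iter j D g).

Definition bidiff_pred (k : nat) : {pred C -> C -> C} :=
  fun A => `[< is_bidiff k A >].

Variable k : nat.

Lemma bidiff_ext A B :
  is_bidiff k A -> (forall f g, B f g = A f g) -> is_bidiff k B.
Proof. by move=> [a aE] BA; exists a => f g; rewrite BA aE. Qed.

Lemma op_addE (A B : C -> C -> C) f g : (A + B) f g = A f g + B f g.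
Proof. by []. Qed.

Lemma bidiff_add A B : is_bidiff k A -> is_bidiff k B -> is_bidiff k (A + B).
Proof.
move=> [a aE] [b bE]; exists (fun i j => a i j + b i j) => f g.
rewrite op_addE aE bE -big_split; apply: eq_bigr => i _.
by rewrite -big_split; apply: eq_bigr => j _ /=; rewrite mulrDl.
Qed.

Lemma bidiff_mul h A : is_bidiff k A -> is_bidiff k (fun f g => h * A f g).
Proof.
move=> [a aE]; exists (fun i j => h * a i j) => f g.
rewrite aE mulr_sumr; apply: eq_bigr => i _.
by rewrite mulr_sumr; apply: eq_bigr => j _ /=; rewrite mulrA.
Qed.

Lemma bidiff_mono h i j : (i + j <= k)%N ->
  is_bidiff k (fun f g => h * (iter i D f * iter j D g)).
Proof.
move=> ijk; exists (fun i' j' => if (i' == i) && (j' == j) then h else 0) => f g.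
have ik : (i < k.+1)%N by rewrite ltnS (leq_trans _ ijk)// leq_addr.
have jk : (j < k.+1)%N by rewrite ltnS (leq_trans _ ijk)// leq_addl.
rewrite (bigD1 (Ordinal ik))//= (bigD1 (Ordinal jk))//= !eqxx/=.
rewrite big1 ?addr0 => [|j' /andP[_ jj]]; last first.
  by rewrite (negbTE jj : (j' == j :> nat) = false) mul0r.
rewrite big1 ?addr0// => i' ii; rewrite big1// => j' _.
by rewrite (negbTE ii : (i' == i :> nat) = false) mul0r.
Qed.

Lemma bidiff_0 : is_bidiff k 0.
Proof.
by exists (fun _ _ => 0) => f g; rewrite big1// => i _; rewrite big1// => j _;
  rewrite mul0r.
Qed.

Lemma bidiff_opp A : is_bidiff k A -> is_bidiff k (- A).
Proof.
move=> /(bidiff_mul (-1))/bidiff_ext; apply => f g.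
by rewrite mulN1r.
Qed.

Lemma bidiff_sum I (r : seq I) (P : pred I) (F : I -> C -> C -> C) :
  (forall i, P i -> is_bidiff k (F i)) -> is_bidiff k (\sum_(i <- r | P i) F i).
Proof. move=> FP; apply: big_ind => //; [exact: bidiff_0|exact: bidiff_add]. Qed.

Lemma iterD_is_linear i : linear (iter i D).
Proof. by elim: i => [|i IHi] c f g //=; rewrite IHi linearP. Qed.

Lemma bidiff_linearl A g : is_bidiff k A -> linear (A^~ g).
Proof.
move=> [a aE] c f h; rewrite !aE scaler_sumr -big_split; apply: eq_bigr => i _.
rewrite scaler_sumr -big_split; apply: eq_bigr => j _ /=.
by rewrite iterD_is_linear !scale_constf; ring.
Qed.

Lemma bidiff_linearr A f : is_bidiff k A -> linear (A f).
Proof.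
move=> [a aE] c g h; rewrite !aE scaler_sumr -big_split; apply: eq_bigr => i _.
rewrite scaler_sumr -big_split; apply: eq_bigr => j _ /=.
by rewrite iterD_is_linear !scale_constf; ring.
Qed.

Section Action.
Variables (lambda : R * R) (mu : R).

Definition op_act (X : Vect R M)
    (A : density M lambda.1 -> density M lambda.2 -> density M mu) :
    density M lambda.1 -> density M lambda.2 -> density M mu :=
  fun phi psi =>
    vm_act X (A phi psi) - A (vm_act X phi) psi - A phi (vm_act X psi).

Lemma iterD_dens_act (l : R) X i : exists e : nat -> C, forall f,
  iter i D (dens_act l X f) =
    X * iter i.+1 D f + \sum_(m < i.+1) e m * iter m D f.
Proof.
elim: i => [|i [e eE]].
  exists (fun=> l *: D X) => f.
  by rewrite big_ord1/= /dens_act !scale_constf mulrA.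
exists (fun m => (if m == i.+1 then D X else D (e m)) +
                 (if m is m'.+1 then e m' else 0)) => f.
rewrite [LHS]/= eE derivD derivM linear_sum /=.
under eq_bigr => m _ do rewrite derivM.
under [in RHS]eq_bigr => m _ do rewrite mulrDl.
rewrite !big_split [X in _ = _ + (X + _)]big_ord_recr /= eqxx.
rewrite [X in _ = _ + (_ + X)]big_ord_recl /= mul0r add0r.
have -> : \sum_(m < i.+1) (if m == i.+1 :> nat then D X else D (e m)) *
            iter m D f = \sum_(m < i.+1) D (e m) * iter m D f.
  by apply: eq_bigr => m _; rewrite (ltn_eqF (ltn_ord m)).
ring.
Qed.

Lemma op_act_mono X (h : C) i j : (i + j <= k)%N ->
  is_bidiff k (op_act X (fun f g => h * (iter i D f * iter j D g))).
Proof.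
move=> ijk; have [e1 e1E] := iterD_dens_act lambda.1 X i.
have [e2 e2E] := iterD_dens_act lambda.2 X j.
pose B1 := \sum_(m < i.+1)
  (fun f g : C => (- h * e1 m) * (iter m D f * iter j D g)).
pose B2 := \sum_(m < j.+1)
  (fun f g : C => (- h * e2 m) * (iter i D f * iter m D g)).
pose B0 := fun f g : C => (X * D h + mu *: D X * h) * (iter i D f * iter j D g).
apply: (@bidiff_ext (B0 + B1 + B2)).
  apply: bidiff_add; first apply: bidiff_add.
  - exact: bidiff_mono.
  - apply: bidiff_sum => m _; apply: bidiff_mono; apply: leq_trans ijk.
    by rewrite leq_add2r -ltnS.
  - apply: bidiff_sum => m _; apply: bidiff_mono; apply: leq_trans ijk.
    by rewrite leq_add2l -ltnS.
move=> f g; rewrite !op_addE /op_act /= e1E e2E.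
have -> : B1 f g = - h * iter j D g * \sum_(m < i.+1) e1 m * iter m D f.
  by rewrite /B1 !fct_sumE mulr_sumr; apply: eq_bigr => m _; ring.
have -> : B2 f g = - h * iter i D f * \sum_(m < j.+1) e2 m * iter m D g.
  by rewrite /B2 !fct_sumE mulr_sumr; apply: eq_bigr => m _; ring.
rewrite /B0 /dens_act !scale_constf !derivM /=; ring.
Qed.

Lemma op_act_linearr X : linear (op_act X).
Proof.
move=> c A B; apply/funext => f; apply/funext => g.
transitivity (c *: op_act X A f g + op_act X B f g) => //.
have E f' g' : (c *: A + B) f' g' = c *: A f' g' + B f' g' by [].
rewrite /op_act !E /= dens_act_linearr !scale_constf; ring.
Qed.

Lemma bidiff_op_act X A : is_bidiff k A -> is_bidiff k (op_act X A).
Proof.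
move=> [a aE].
pose B : C -> C -> C := \sum_(i < k.+1) \sum_(j < k.+1 | (i + j <= k)%N)
  (fun f g : C => a i j * (iter i D f * iter j D g)).
have -> : A = B.
  apply/funext => f; apply/funext => g; rewrite aE /B !fct_sumE.
  by apply: eq_bigr => i _; rewrite !fct_sumE.
have op_act0 : is_bidiff k (op_act X 0).
  apply: (bidiff_ext bidiff_0) => f g.
  have := op_act_linearr X 0 0 0; rewrite !scale0r addr0 add0r => /esym E.
  by have := op_act_linearr X (-1) 0 0; rewrite !scaler0 addr0 scaleN1r addNr => ->.
have op_actD A1 A2 : is_bidiff k (op_act X A1) -> is_bidiff k (op_act X A2) ->
    is_bidiff k (op_act X (A1 + A2)).
  move=> b1 b2; have := op_act_linearr X 1 A1 A2; rewrite !scale1r => ->.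
  exact: bidiff_add.
pose K A' := is_bidiff k (op_act X A').
rewrite /B; apply: (big_ind K) => // i _; apply: (big_ind K) => // j ijk.
exact: op_act_mono.
Qed.

Record bidiffop := BidiffOp {
  bidiffop_val :>
    density M lambda.1 -> density M lambda.2 -> density M mu;
  bidiffopP : bidiffop_val \in bidiff_pred k }.

HB.instance Definition _ := [isSub of bidiffop for bidiffop_val].
HB.instance Definition _ := [Choice of bidiffop by <:].

Lemma bidiff_submod : subsemimod_closed
  (bidiff_pred k : {pred density M lambda.1 -> density M lambda.2 -> density M mu}).
Proof.
split; first split=> [|A B /asboolP bA /asboolP bB].
- exact/asboolP/bidiff_0.
- exact/asboolP/bidiff_add.
move=> c A /asboolP bA; apply/asboolP.
apply: (bidiff_ext (bidiff_mul (constf M c) bA)) => f g.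
by rewrite -scale_constf.
Qed.

Lemma bidiff_zmod : zmod_closed
  (bidiff_pred k : {pred density M lambda.1 -> density M lambda.2 -> density M mu}).
Proof.
split=> [|A B /asboolP bA /asboolP bB]; first exact/asboolP/bidiff_0.
by apply/asboolP/bidiff_add => //; exact: bidiff_opp.
Qed.

HB.instance Definition _ :=
  GRing.SubChoice_isSubZmodule.Build _ _ bidiffop bidiff_zmod.
HB.instance Definition _ :=
  GRing.SubZmodule_isSubLmodule.Build _ _ _ bidiffop bidiff_submod.

Lemma bidiff_act_subproof X (A : bidiffop) : op_act X A \in bidiff_pred k.
Proof. by apply/asboolP/bidiff_op_act/asboolP/bidiffopP. Qed.

Definition bidiff_act X (A : bidiffop) : bidiffop :=
  BidiffOp (bidiff_act_subproof X A).

Lemma bidiff_act_linearl A : linear (bidiff_act^~ A).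
Proof.
move=> c X Y; apply/val_inj/funext => f; apply/funext => g.
have /asboolP bA := bidiffopP A.
transitivity (c *: op_act X A f g + op_act Y A f g) => //.
rewrite /= /op_act /= !dens_act_linearl.
rewrite (bidiff_linearl g bA) (bidiff_linearr f bA) !scale_constf; ring.
Qed.

Lemma bidiff_act_linearr X : linear (bidiff_act X).
Proof. by move=> c A B; apply/val_inj; rewrite /= op_act_linearr. Qed.

Lemma bidiff_act_bracket X Y A :
  bidiff_act (vect_bracket X Y) A =
    bidiff_act X (bidiff_act Y A) - bidiff_act Y (bidiff_act X A).
Proof.
apply/val_inj/funext => f; apply/funext => g.
have /asboolP bA := bidiffopP A.
transitivity (op_act X (op_act Y A) f g - op_act Y (op_act X A) f g) => //.
have subl f1 f2 g' : A (f1 - f2) g' = A f1 g' - A f2 g'.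
  by have := bidiff_linearl g' bA (-1) f2 f1; rewrite !scaleN1r ![- _ + _]addrC.
have subr f' g1 g2 : A f' (g1 - g2) = A f' g1 - A f' g2.
  by have := bidiff_linearr f' bA (-1) g2 g1; rewrite !scaleN1r ![- _ + _]addrC.
have actB h1 h2 Z : dens_act mu Z (h1 - h2) = dens_act mu Z h1 - dens_act mu Z h2.
  by have := dens_act_linearr mu Z (-1) h2 h1; rewrite !scaleN1r ![- _ + _]addrC.
rewrite /= /op_act /= !dens_act_bracket subl subr !actB; ring.
Qed.

Definition bidiff_module : vect_module R M :=
  VectModule bidiff_act_linearl bidiff_act_linearr bidiff_act_bracket.

End Action.
End BidifferentialOperators.

Definition weight (R : realType) (lambda : R * R) : R := lambda.1 + lambda.2.

(* Main.v *)
(** Identify [a f g + b f' g + c f g'] with the triple [(a, b, c)].  In shift 1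
    the action reads
      [X.(a, b, c) = (X a' + X' a - (lambda1 b + lambda2 c) X'', X b', X c')],
    so it only depends on [lambda] through the functional
    [lambda1 b + lambda2 c].  All nonzero functionals are equivalent under linear
    changes of [(b, c)], which gives the isomorphisms.  The invariants of the
    module are the triples [(0, b, c)] with [b] and [c] constant and
    [lambda1 b + lambda2 c = 0]: they form a line if [lambda <> 0] and a plane if
    [lambda = 0]. *)
Require Import Defs.
From HB Require Import structures.
From mathcomp Require Import all_boot all_order all_algebra.
From mathcomp Require Import all_classical all_reals all_analysis.
From mathcomp Require Import ring.
Set Implicit Arguments.
Unset Strict Implicit.
Unset Printing Implicit Defensive.
Import Order.TTheory GRing.Theory Num.Theory.
Import numFieldNormedType.Exports.
Local Open Scope ring_scope.

Section Trigonometric.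
Variables (R : realType) (M : manifold1).
Local Notation C := (smoothfun R M).
Local Notation D := (@Defs.deriv R M).

Lemma is_derive_sin_cos (a b x : R) :
  is_derive x 1 (fun t : R => a * sin t + b * cos t) (- b * sin x + a * cos x).
Proof.
have -> : - b * sin x + a * cos x = a *: cos x + b *: - sin x.
  by rewrite /GRing.scale /=; ring.
exact: (is_deriveD (is_deriveZ a (is_derive_sin x)) (is_deriveZ b (is_derive_cos x))).
Qed.

Lemma smooth_sin_cos (a b : R) : smooth (fun t : R => a * sin t + b * cos t).
Proof.
move=> n; elim: n a b => [|n IHn] a b x; first exact: (@ex_derive _ _ _ _ _ _ _ (is_derive_sin_cos a b x)).
rewrite derive1Sn (_ : derive1 _ = fun t : R => - b * sin t + a * cos t) //.
apply/funext => t; rewrite derive1E.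
exact: (@derive_val _ _ _ _ _ _ _ (is_derive_sin_cos a b t)).
Qed.

Lemma smooth_on_sin_cos (a b : R) :
  (fun t : R => a * sin t + b * cos t) \in smooth_on_pred M.
Proof.
apply/asboolP; split; first exact: smooth_sin_cos.
by case: M => // u; rewrite sinD2pi cosD2pi.
Qed.

Definition trigf (a b : R) : C := SmoothFun (smooth_on_sin_cos a b).

Definition sinf : C := trigf 1 0.
Definition cosf : C := trigf 0 1.

Lemma deriv_trigf a b : D (trigf a b) = trigf (- b) a.
Proof.
apply/val_inj/funext => x /=; rewrite derive1E.
exact: (@derive_val _ _ _ _ _ _ _ (is_derive_sin_cos a b x)).
Qed.

Lemma deriv_sinf : D sinf = cosf.
Proof. by rewrite deriv_trigf oppr0. Qed.

Lemma deriv_cosf : D cosf = - sinf.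
Proof.
rewrite deriv_trigf; apply/val_inj/funext => x /=.
by rewrite {2}/GRing.opp /= !mul0r !addr0 mul1r mulN1r.
Qed.

Lemma cosf2Dsinf2 : cosf * cosf + sinf * sinf = 1.
Proof.
apply/val_inj/funext => x.
transitivity (cosf x * cosf x + sinf x * sinf x) => //=.
by rewrite !(mul0r, mul1r, addr0, add0r) -!expr2 cos2Dsin2.
Qed.

Lemma constfD (a b : R) : constf M (a + b) = constf M a + constf M b.
Proof. exact/val_inj. Qed.

Lemma constfM (a b : R) : constf M (a * b) = constf M a * constf M b.
Proof. exact/val_inj. Qed.

Lemma constf0 : constf M (0 : R) = 0.
Proof. exact/val_inj. Qed.

Lemma constf1 : constf M (1 : R) = 1.
Proof. exact/val_inj. Qed.

Lemma constf_inj : injective (@constf R M).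
Proof. by move=> a b /(congr1 (fun f : C => f 0)). Qed.

Lemma deriv1 : D (1 : C) = 0.
Proof. by rewrite -constf1 deriv_constf. Qed.

Lemma deriv_eq0_constf (f : C) : D f = 0 -> f = constf M (f 0).
Proof.
move=> f'0; apply/val_inj/funext => x /=.
apply: is_derive_0_is_cst => t.
apply: DeriveDef; first exact: smoothfun_derivable.
by rewrite -derive1E; exact: (congr1 (fun g : C => g t) f'0).
Qed.

End Trigonometric.
Arguments sinf {R M}.
Arguments cosf {R M}.

Section OrderOne.
Variables (R : realType) (M : manifold1).
Local Notation C := (smoothfun R M).
Local Notation D := (@Defs.deriv R M).
Implicit Types (f g a b c X : C) (A B : C -> C -> C).

Definition order1 a b c : C -> C -> C :=
  fun f g => a * (f * g) + b * (D f * g) + c * (f * D g).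

Lemma bidiff_order1 a b c : is_bidiff 1 (order1 a b c).
Proof.
have h := bidiff_add (bidiff_add (bidiff_mono (k := 1) (i := 0) (j := 0) a isT)
  (bidiff_mono (k := 1) (i := 1) (j := 0) b isT))
  (bidiff_mono (k := 1) (i := 0) (j := 1) c isT).
exact: (bidiff_ext h).
Qed.

Lemma bidiff1P A : is_bidiff 1 A -> exists a b c, A = order1 a b c.
Proof.
move=> [e eE]; exists (e 0 0)%N, (e 1 0)%N, (e 0 1)%N; apply/funext => f; apply/funext => g.
rewrite eE /order1 !big_ord_recl !big_ord0 /=.
by do 2 rewrite big_mkcond !big_ord_recl !big_ord0 /=; ring.
Qed.

(* On the circle there is no coordinate function, so the coefficients of [f' g]
   and [f g'] are read off from the values on [sin] and [cos]. *)
Definition coef0 A : C := A 1 1.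
Definition coefl A : C := cosf * A sinf 1 - sinf * A cosf 1.
Definition coefr A : C := cosf * A 1 sinf - sinf * A 1 cosf.

Lemma coef0_order1 a b c : coef0 (order1 a b c) = a.
Proof. by rewrite /coef0 /order1 !deriv1; ring. Qed.

Lemma coefl_order1 a b c : coefl (order1 a b c) = b.
Proof.
rewrite /coefl /order1 !deriv1 deriv_sinf deriv_cosf.
by rewrite -[RHS]mulr1 -[in RHS](cosf2Dsinf2 R M); ring.
Qed.

Lemma coefr_order1 a b c : coefr (order1 a b c) = c.
Proof.
rewrite /coefr /order1 !deriv1 deriv_sinf deriv_cosf.
by rewrite -[RHS]mulr1 -[in RHS](cosf2Dsinf2 R M); ring.
Qed.

Lemma order1_inj a b c a' b' c' :
  order1 a b c = order1 a' b' c' -> [/\ a = a', b = b' & c = c'].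
Proof.
move=> e; split.
- by rewrite -(coef0_order1 a b c) e coef0_order1.
- by rewrite -(coefl_order1 a b c) e coefl_order1.
- by rewrite -(coefr_order1 a b c) e coefr_order1.
Qed.

Lemma op_act_order1 (lambda : R * R) X a b c :
  op_act (lambda := lambda) (mu := 1 + weight lambda) X (order1 a b c) =
  order1 (X * D a + D X * a
            - D (D X) * (constf M lambda.1 * b + constf M lambda.2 * c))
         (X * D b) (X * D c).
Proof.
apply/funext => f; apply/funext => g.
rewrite /op_act /order1 /= /dens_act /weight !scale_constf !constfD constf1.
rewrite !(Defs.derivD, Defs.derivM, deriv_constf); ring.
Qed.

End OrderOne.

Section Modules.
Variables (R : realType) (M : manifold1).
Local Notation C := (smoothfun R M).
Local Notation D := (@Defs.deriv R M).

Section Order1op.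
Variables (lambda : R * R) (mu : R).

Lemma order1op_subproof (a b c : C) : order1 a b c \in bidiff_pred 1.
Proof. exact/asboolP/bidiff_order1. Qed.

Definition order1op (a b c : C) : bidiffop M 1 lambda mu :=
  BidiffOp (order1op_subproof a b c).

Lemma order1opP (A : bidiffop M 1 lambda mu) : exists a b c, A = order1op a b c.
Proof.
have /asboolP/bidiff1P[a [b [c e]]] := bidiffopP A.
by exists a, b, c; exact/val_inj.
Qed.

Lemma order1op_inj a b c a' b' c' :
  order1op a b c = order1op a' b' c' -> [/\ a = a', b = b' & c = c'].
Proof. by move/(congr1 val)/order1_inj. Qed.

Lemma order1op0 : order1op 0 0 0 = 0.
Proof.
by apply/val_inj/funext => f; apply/funext => g; rewrite /= /order1 !mul0r !addr0.
Qed.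

Lemma order1op_lin (k : R) a b c a' b' c' :
  k *: order1op a b c + order1op a' b' c' =
  order1op (k *: a + a') (k *: b + b') (k *: c + c').
Proof.
apply/val_inj/funext => f; apply/funext => g.
transitivity (k *: order1 a b c f g + order1 a' b' c' f g) => //.
rewrite /= /order1 !scale_constf; ring.
Qed.

End Order1op.

Lemma bidiff_act_order1op (lambda : R * R) (X : C) a b c :
  bidiff_act X (order1op lambda (1 + weight lambda) a b c) =
  order1op lambda (1 + weight lambda)
    (X * D a + D X * a
       - D (D X) * (constf M lambda.1 * b + constf M lambda.2 * c))
    (X * D b) (X * D c).
Proof. by apply/val_inj; rewrite /= op_act_order1. Qed.

Section Similarity.
Variables (lambda rho : R * R) (mu nu : R).

(* Multiplication of [c + i b] by [u + i v]. *)
Definition similarity (u v : R) (A : bidiffop M 1 lambda mu) :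
    bidiffop M 1 rho nu :=
  order1op rho nu (coef0 A) (u *: coefl A + v *: coefr A)
                            (u *: coefr A - v *: coefl A).

Lemma similarityE u v a b c : similarity u v (order1op lambda mu a b c) =
  order1op rho nu a (u *: b + v *: c) (u *: c - v *: b).
Proof. by rewrite /similarity coef0_order1 coefl_order1 coefr_order1. Qed.

Lemma similarity_is_linear u v : linear (similarity u v).
Proof.
move=> k A B; have [a [b [c ->]]] := order1opP A.
have [a' [b' [c' ->]]] := order1opP B.
rewrite order1op_lin !similarityE order1op_lin !scale_constf.
congr order1op; ring.
Qed.

HB.instance Definition _ u v :=
  GRing.isLinear.Build R (bidiffop M 1 lambda mu) (bidiffop M 1 rho nu) *:%R
    (similarity u v) (similarity_is_linear u v).

End Similarity.

Lemma similarityK (lambda rho : R * R) (mu nu u v u' v' : R) :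
  u * u' - v * v' = 1 -> u * v' + v * u' = 0 ->
  cancel (@similarity lambda rho mu nu u v) (@similarity rho lambda nu mu u' v').
Proof.
move=> e1 e0 A; have [a [b [c ->]]] := order1opP A.
rewrite !similarityE; congr order1op; apply/val_inj/funext => x /=.
- transitivity (u' * (u * b x + v * c x) + v' * (u * c x - v * b x)) => //.
  transitivity ((u * u' - v * v') * b x + (u * v' + v * u') * c x); first by ring.
  by rewrite e1 e0 mul1r mul0r addr0.
- transitivity (u' * (u * c x - v * b x) - v' * (u * b x + v * c x)) => //.
  transitivity ((u * u' - v * v') * c x - (u * v' + v * u') * b x); first by ring.
  by rewrite e1 e0 mul1r mul0r subr0.
Qed.

Lemma sqr_norm_neq0 (lambda : R * R) :
  lambda <> 0 -> lambda.1 * lambda.1 + lambda.2 * lambda.2 != 0.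
Proof.
case: lambda => l1 l2 /eqP; apply: contraNN; rewrite -!expr2 /=.
by rewrite paddr_eq0 ?sqr_ge0 // !sqrf_eq0 => /andP[/eqP -> /eqP ->].
Qed.

Lemma similarity_iso (lambda rho : R * R) : lambda <> 0 -> rho <> 0 ->
  vect_isomorphic (bidiff_module M 1 lambda (1 + weight lambda))
                  (bidiff_module M 1 rho (1 + weight rho)).
Proof.
move=> /sqr_norm_neq0 l0 /sqr_norm_neq0 r0.
(* [ratio p q] holds the real and imaginary parts of [p / q] in the complex plane *)
pose ratio (p q : R * R) := ((p.1 * q.1 + p.2 * q.2) / (q.1 * q.1 + q.2 * q.2),
  (p.2 * q.1 - p.1 * q.2) / (q.1 * q.1 + q.2 * q.2)).
have ratioV1 p q : p.1 * p.1 + p.2 * p.2 != 0 -> q.1 * q.1 + q.2 * q.2 != 0 ->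
    (ratio p q).1 * (ratio q p).1 - (ratio p q).2 * (ratio q p).2 = 1.
  by move=> p0 q0 /=; field; rewrite p0 q0.
have ratioV0 p q : p.1 * p.1 + p.2 * p.2 != 0 -> q.1 * q.1 + q.2 * q.2 != 0 ->
    (ratio p q).1 * (ratio q p).2 + (ratio p q).2 * (ratio q p).1 = 0.
  by move=> p0 q0 /=; field; rewrite p0 q0.
set u := (ratio lambda rho).1; set v := (ratio lambda rho).2.
have eq1 : lambda.1 = rho.1 * u - rho.2 * v by rewrite /u /v /=; field.
have eq2 : lambda.2 = rho.1 * v + rho.2 * u by rewrite /u /v /=; field.
exists (@similarity lambda rho (1 + weight lambda) (1 + weight rho) u v).
split.
  exists (@similarity rho lambda (1 + weight rho) (1 + weight lambda)
            (ratio rho lambda).1 (ratio rho lambda).2).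
  - by apply: similarityK; [exact: ratioV1|exact: ratioV0].
  - by apply: similarityK; [exact: ratioV1|exact: ratioV0].
move=> X A; have [a [b [c ->]]] := order1opP A.
rewrite /= bidiff_act_order1op !similarityE bidiff_act_order1op.
rewrite !scale_constf.
have -> : constf M lambda.1 =
    constf M rho.1 * constf M u - constf M rho.2 * constf M v.
  by rewrite eq1; exact/val_inj.
have -> : constf M lambda.2 =
    constf M rho.1 * constf M v + constf M rho.2 * constf M u.
  by rewrite eq2; exact/val_inj.
rewrite !(Defs.derivD, Defs.derivN, Defs.derivM, deriv_constf).
congr order1op; ring.
Qed.

Definition invariant (V : vect_module R M) (v : V) := forall X, vm_act X v = 0.

Lemma invariant_order1op (lambda : R * R)
    (A : bidiff_module M 1 lambda (1 + weight lambda)) :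
  invariant A -> exists b c : R,
    A = order1op lambda (1 + weight lambda) 0 (constf M b) (constf M c) /\
    lambda.1 * b + lambda.2 * c = 0.
Proof.
have [a [b [c ->]]] := order1opP A => inv.
have {inv}eqs X : [/\ X * D a + D X * a
    - D (D X) * (constf M lambda.1 * b + constf M lambda.2 * c) = 0,
    X * D b = 0 & X * D c = 0].
  by apply: (@order1op_inj lambda (1 + weight lambda));
     rewrite -bidiff_act_order1op order1op0; exact: inv.
have [] := eqs 1; rewrite !deriv1 (linear0 D) !mul1r !mul0r subr0 addr0.
move=> a'0 /deriv_eq0_constf b_cst /deriv_eq0_constf c_cst.
set k := _ + _ in eqs.
have [+ _ _] := eqs cosf; have [+ _ _] := eqs sinf.
rewrite !(deriv_sinf, deriv_cosf, Defs.derivN) a'0 !mulr0 !add0r => sin_eq cos_eq.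
have a0 : a = 0.
  rewrite -[a]mul1r -(cosf2Dsinf2 R M).
  transitivity (cosf * (cosf * a - (- sinf) * k)
                - sinf * (- sinf * a - - cosf * k)); first by ring.
  by rewrite sin_eq cos_eq !mulr0 subr0.
have k0 : k = 0.
  rewrite -[k]mul1r -(cosf2Dsinf2 R M).
  transitivity (sinf * (cosf * a - (- sinf) * k)
                + cosf * (- sinf * a - - cosf * k)); first by ring.
  by rewrite sin_eq cos_eq !mulr0 addr0.
exists (b 0), (c 0); split; first by rewrite -b_cst -c_cst a0.
by move: k0 => /(congr1 (fun f : C => f 0)).
Qed.

Lemma invariant_collinear (lambda : R * R)
    (A B : bidiff_module M 1 lambda (1 + weight lambda)) : lambda <> 0 ->
  invariant A -> invariant B ->
  exists s t : R, (s, t) <> 0 /\ s *: A + t *: B = 0.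
Proof.
move=> l0 /invariant_order1op[b [c [-> e]]] /invariant_order1op[b' [c' [-> e']]].
have comb (s t : R) : s * b + t * b' = 0 -> s * c + t * c' = 0 ->
    s *: order1op lambda (1 + weight lambda) 0 (constf M b) (constf M c) +
    t *: order1op lambda (1 + weight lambda) 0 (constf M b') (constf M c') = 0.
  move=> eb ec; rewrite -[t *: _]addr0 -(order1op0 lambda (1 + weight lambda)).
  rewrite !order1op_lin !addr0 !scaler0 addr0 !scale_constf -!constfM -!constfD.
  by rewrite eb ec constf0.
have det0 : b * c' - b' * c = 0.
  have m1 : lambda.1 * (b * c' - b' * c) = 0.
    transitivity (c' * (lambda.1 * b + lambda.2 * c)
                  - c * (lambda.1 * b' + lambda.2 * c')); first by ring.
    by rewrite e e' !mulr0 subr0.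
  have m2 : lambda.2 * (b * c' - b' * c) = 0.
    transitivity (b * (lambda.1 * b' + lambda.2 * c')
                  - b' * (lambda.1 * b + lambda.2 * c)); first by ring.
    by rewrite e e' !mulr0 subr0.
  apply: (mulfI (sqr_norm_neq0 l0)); rewrite mulr0 mulrDl.
  by rewrite -!mulrA m1 m2 !mulr0 addr0.
have [bb0|bb0] := eqVneq (b, b') 0; last first.
  exists (- b'), b; split; last by apply: comb; [ring|rewrite -det0; ring].
  by move=> [/eqP]; rewrite oppr_eq0 => /eqP b'0 b0; rewrite b0 b'0 eqxx in bb0.
case: bb0 => b0 b'0.
have [cc0|cc0] := eqVneq (c, c') 0; last first.
  exists (- c'), c; split; last by apply: comb; [rewrite b0 b'0; ring|ring].
  by move=> [/eqP]; rewrite oppr_eq0 => /eqP c'0 c0; rewrite c0 c'0 eqxx in cc0.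
case: cc0 => c0 c'0; exists 1, 0; split; first by move=> [/eqP]; rewrite oner_eq0.
by apply: comb; rewrite ?b0 ?b'0 ?c0 ?c'0; ring.
Qed.

Lemma invariant_constf0 (b c : R) :
  invariant (order1op 0 1 0 (constf M b) (constf M c) : bidiff_module M 1 0 1).
Proof.
have w0 : 1 = 1 + weight (0 : R * R) by rewrite /weight /= !addr0.
move=> X; rewrite w0 /= bidiff_act_order1op (linear0 D) !deriv_constf.
by rewrite !constf0 !mul0r !mulr0 !addr0 mulr0 subr0 order1op0.
Qed.

Lemma not_iso0 (lambda : R * R) : lambda <> 0 ->
  ~ vect_isomorphic (bidiff_module M 1 lambda (1 + weight lambda))
                    (bidiff_module M 1 0 1).
Proof.
move=> l0 [T [[T' TK T'K] Tact]].
have inv v : invariant v -> invariant (T' v).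
  by move=> vi X; apply: (can_inj TK); rewrite Tact T'K vi linear0.
have [s [t [st0 /(congr1 T)]]] := invariant_collinear l0
  (inv _ (invariant_constf0 1 0)) (inv _ (invariant_constf0 0 1)).
rewrite linear0 linearD !linearZ !T'K => st_eq.
have : s *: order1op 0 1 0 (constf M 1) (constf M 0) +
       t *: order1op 0 1 0 (constf M 0) (constf M 1) = 0 by exact: st_eq.
have -> : t *: order1op 0 1 0 (constf M 0) (constf M 1) =
    order1op 0 1 0 (constf M 0) (constf M t).
  rewrite -[LHS]addr0 -(order1op0 0 1) order1op_lin scaler0 !addr0.
  by rewrite !scale_constf -!constfM mulr0 mulr1.
rewrite order1op_lin -(order1op0 0 1) => /order1op_inj[_].
rewrite !scale_constf -!constfM -!constfD mulr0 mulr1 addr0 add0r -constf0.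
by move=> /constf_inj s0 /constf_inj t0; apply: st0; rewrite s0 t0.
Qed.

End Modules.

Theorem theorem10p4 (R : realType) (M : manifold1) :
  (forall lambda rho : R * R, lambda <> 0 -> rho <> 0 ->
     vect_isomorphic (bidiff_module M 1 lambda (1 + weight lambda))
                     (bidiff_module M 1 rho (1 + weight rho))) /\
  (forall lambda : R * R, lambda <> 0 ->
     ~ vect_isomorphic (bidiff_module M 1 lambda (1 + weight lambda))
                       (bidiff_module M 1 0 1)).
Proof.
split=> [lambda rho l0 r0|lambda l0]; first exact: similarity_iso.
exact: not_iso0.
Qed.
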